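(* Let real numbers $s_{m,n}$, $m,n\in\{0,1,2,3\}$, be given such that $$ s_{0,0}>0,\qquad s_{0,0}s_{0,2}-s_{0,1}^2>0,\qquad s_{0,0}s_{2,0}-s_{1,0}^2>0. $$ Let $I_1$, $I_2$, $I_3$ be the sets of positive real numbers $a_2$ satisfying, respectively, the inequalities $$ (-a_2^2 s_{0,0}+s_{0,2})(-a_2^2 s_{2,0}+s_{2,2})>(-a_2^2 s_{1,0}+s_{1,2})^2, $$ $$ (a_2 s_{0,0}-s_{0,1})(a_2 s_{2,0}-s_{2,1})>(a_2 s_{1,0}-s_{1,1})^2, $$ $$ (a_2 s_{0,0}+s_{0,1})(a_2 s_{2,0}+s_{2,1})>(a_2 s_{1,0}+s_{1,1})^2. $$ If $$ \left(\frac{|s_{0,1}|}{s_{0,0}},\ \sqrt{\frac{s_{0,2}}{s_{0,0}}}\right)\cap I_1\cap I_2\cap I_3\neq\emptyset, $$ then the truncated two-dimensional moment problem with $M=N=3$ has a solution, i.e. there exists a non-negative measure $\mu$ on $\mathfrak{B}(\mathbb{R}^2)$ such that $\int_{\mathbb{R}^2}x_1^m x_2^n\,d\mu=s_{m,n}$ for all $m,n\in\{0,1,2,3\}$. Moreover, for an arbitrary $a_2\in\left(\frac{|s_{0,1}|}{s_{0,0}},\sqrt{\frac{s_{0,2}}{s_{0,0}}}\right)\cap I_1\cap I_2\cap I_3$ and some positive (large) $a_3>a_2$, the truncated $K_3(-a_3,-a_2,a_2,a_3)$-moment problem with the same data $\{s_{m,n}\}_{m,n\in\{0,1,2,3\}}$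 is solvable, and a solution $\mu$ of the moment problem can be obtained as a solution of this truncated $K_3(-a_3,-a_2,a_2,a_3)$-moment problem.
   Context: $\mathfrak{B}(\mathbb{R}^2)$ denotes the Borel subsets of $\mathbb{R}^2$, and $x^0=1$ by convention. A solution of a moment problem is a non-negative Borel measure for which all the listed integrals exist (converge absolutely) and have the prescribed values. For real $a_0<a_1<a_2<a_3$, set $K_3(a_0,a_1,a_2,a_3)=\bigcup_{j=0}^3\{(x_1,x_2)\in\mathbb{R}^2: x_2=a_j\}$; here it is used with $a_0=-a_3$, $a_1=-a_2$. For a set $K\subseteq\mathbb{R}^2$, the truncated $K$-moment problem with data $\{s_{m,n}\}_{0\le m\le M,\,0\le n\le N}$ is: find a non-negative measure $\mu$ on $\mathfrak{B}(\mathbb{R}^2)$ with $\int_{\mathbb{R}^2}x_1^m x_2^n\,d\mu=s_{m,n}$ for all $0\le m\le M$, $0\le n\le N$, and $\mathrm{supp}\,\mu\subseteq K$. *)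

(* Defs.v *)
From HB Require Import structures.
From mathcomp Require Import all_boot all_order all_algebra.
From mathcomp Require Import all_classical all_reals all_analysis.

Set Implicit Arguments.
Unset Strict Implicit.
Unset Printing Implicit Defensive.

Import Order.TTheory GRing.Theory Num.Theory.
Import numFieldNormedType.Exports.

Local Open Scope classical_set_scope.
Local Open Scope ring_scope.

(* R^2 with its Borel sigma-algebra, i.e. the one generated by the open sets
   of the product topology (rather than the instance on R * R generated by
   measurable rectangles).  Points are pairs x, with x.1 = x_1, x.2 = x_2. *)
Notation borel_plane R := (g_sigma_algebraType (@open (R * R)%type)).

Definition monomial (R : realType) (m n : nat) (x : borel_plane R) : R :=
  x.1 ^+ m * x.2 ^+ n.

(* The values s m n with M < m or N < n are irrelevant. *)
Definition solves_moment_problem (R : realType) (M N : nat)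
    (s : nat -> nat -> R) (mu : {measure set (borel_plane R) -> \bar R}) : Prop :=
  forall m n : nat, (m <= M)%N -> (n <= N)%N ->
    mu.-integrable setT (fun x => (monomial m n x)%:E) /\
    (\int[mu]_x (monomial m n x)%:E = (s m n)%:E)%E.

Definition measure_support (R : realType)
    (mu : {measure set (borel_plane R) -> \bar R}) : set (R * R) :=
  [set x | forall U : set (R * R), open U -> U x -> (0 < mu U)%E].

Definition solves_K_moment_problem (R : realType) (K : set (R * R)) (M N : nat)
    (s : nat -> nat -> R) (mu : {measure set (borel_plane R) -> \bar R}) : Prop :=
  solves_moment_problem M N s mu /\ measure_support mu `<=` K.

Definition K3 (R : realType) (a0 a1 a2 a3 : R) : set (R * R) :=
  [set x | x.2 = a0] `|` [set x | x.2 = a1] `|`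
  [set x | x.2 = a2] `|` [set x | x.2 = a3].

Definition I1 (R : realType) (s : nat -> nat -> R) : set R :=
  [set a2 | 0 < a2 /\
    (- a2 ^+ 2 * s 0%N 0%N + s 0%N 2%N) * (- a2 ^+ 2 * s 2%N 0%N + s 2%N 2%N)
      > (- a2 ^+ 2 * s 1%N 0%N + s 1%N 2%N) ^+ 2].

Definition I2 (R : realType) (s : nat -> nat -> R) : set R :=
  [set a2 | 0 < a2 /\
    (a2 * s 0%N 0%N - s 0%N 1%N) * (a2 * s 2%N 0%N - s 2%N 1%N)
      > (a2 * s 1%N 0%N - s 1%N 1%N) ^+ 2].

Definition I3 (R : realType) (s : nat -> nat -> R) : set R :=
  [set a2 | 0 < a2 /\
    (a2 * s 0%N 0%N + s 0%N 1%N) * (a2 * s 2%N 0%N + s 2%N 1%N)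
      > (a2 * s 1%N 0%N + s 1%N 1%N) ^+ 2].

Definition admissible_a2 (R : realType) (s : nat -> nat -> R) : set R :=
  `](`|s 0%N 1%N| / s 0%N 0%N), (Num.sqrt (s 0%N 2%N / s 0%N 0%N))[%classic
    `&` I1 s `&` I2 s `&` I3 s.

(* Main.v *)
Require Import Defs.
From HB Require Import structures.
From mathcomp Require Import all_boot all_order all_algebra.
From mathcomp Require Import all_classical all_reals all_analysis.
From mathcomp Require Import measurable_realfun ring lra.

Set Implicit Arguments.
Unset Strict Implicit.
Unset Printing Implicit Defensive.

Import Order.TTheory GRing.Theory Num.Theory.
Import numFieldNormedType.Exports.

Local Open Scope classical_set_scope.
Local Open Scope ring_scope.

(** Write [a] for the given admissible value and [b] for the ordinate still to
    be chosen.  A measure carried by the four lines [x_2 = -b, -a, a, b] is a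
    family of four measures on the real line.  If the one carried by [x_2 = c]
    has moments [t_c m], the moment equations read
    [s m n = \sum_c t_c m * c ^+ n] for [n <= 3].  As there are as many lines
    as exponents [n], this Vandermonde system has exactly one solution, given by
    Lagrange interpolation:
    - [t_b m] and [t_{-b} m] are
      [b * (s m 2 - a ^+ 2 * s m 0) +- (s m 3 - a ^+ 2 * s m 1)]
      divided by [2 * b * (b ^+ 2 - a ^+ 2)];
    - [t_a m] and [t_{-a} m] are
      [b ^+ 2 * (a * s m 0 +- s m 1) - (a * s m 2 +- s m 3)]
      divided by [2 * a * (b ^+ 2 - a ^+ 2)].

    On one line, the moments of order at most 3 come from a measure as soon as
    the Hankel matrix [t 0, t 1; t 1, t 2] is positive definite: the two-node
    Gauss quadrature formula is then such a measure ([two_atom_quadrature]).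
    The leading coefficients in [b] of the four families above are
    [s m 2 - a ^+ 2 * s m 0] (twice) and [a * s m 0 +- s m 1].  Positivity of
    their Hankel determinants is what membership in [I1], [I3] and [I2] says,
    and positivity of their terms of order 0 is what
    [`|s 0 1| / s 0 0 < a < sqrt (s 0 2 / s 0 0)] says.  Positive definiteness
    is an open condition, so the lower order terms are harmless once [b] is
    large ([pos_hankel_perturb]), and the eight atoms obtained on the four lines
    form the required measure ([K3_problem_of_lines]). *)

(** * Finitely atomic measures *)

(** A list of pairs (weight, point) stands for the corresponding sum of Dirac
    masses; this is the integral of [f] against it. *)
Definition atomic_sum (R : realType) (T : Type) (l : seq (R * T)) (f : T -> R) : R :=
  \sum_(p <- l) p.1 * f p.2.

Definition nonneg_weights (R : realType) (T : Type) (l : seq (R * T)) : bool :=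
  all (fun p => 0 <= p.1) l.

(** Each step adds one scaled Dirac mass.  Integrals are additive in the measure
    without further conditions for nonnegative integrands, so signed integrands
    are left to [atomic_measure]. *)
Lemma atomic_measure_ge0 (d : measure_display) (T : measurableType d)
    (R : realType) (l : seq (R * T)) : nonneg_weights l ->
  exists mu : {measure set T -> \bar R}, forall f : T -> R,
    measurable_fun setT f -> (forall x, 0 <= f x) ->
    (\int[mu]_x (f x)%:E = (atomic_sum l f)%:E)%E.
Proof.
rewrite /atomic_sum; elim: l => [_|[w x] l ih /= /andP[w0 /ih[mu Hmu]]].
  by exists mzero => f mf f0; rewrite integral_measure_zero big_nil.
exists (measure_add (mscale (NngNum w0) (dirac x)) mu) => f mf f0.
have mEf : measurable_fun setT (fun y : T => (f y)%:E) by exact/measurable_EFinP.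
rewrite ge0_integral_measure_add//; last by move=> y _; rewrite lee_fin.
rewrite ge0_integral_mscale//; last by move=> y _; rewrite lee_fin.
by rewrite integral_dirac// diracT mul1e Hmu// big_cons EFinD EFinM.
Qed.

(** Integrals of nonnegative functions determine the rest: [`|f|] gives
    integrability, [f^\+] and [f^\-] the integral of [f], and indicators the
    measure of sets. *)
Lemma atomic_measure (d : measure_display) (T : measurableType d)
    (R : realType) (l : seq (R * T)) : nonneg_weights l ->
  exists mu : {measure set T -> \bar R},
    (forall f : T -> R, measurable_fun setT f ->
       mu.-integrable setT (EFin \o f) /\
       (\int[mu]_x (f x)%:E = (atomic_sum l f)%:E)%E) /\
    (forall A : set T, measurable A -> mu A = (atomic_sum l \1_A)%:E).
Proof.
move=> l0; have [mu Hmu] := @atomic_measure_ge0 d T R l l0; exists mu; split.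
  move=> f mf.
  have mp : measurable_fun setT f^\+%R by exact: measurable_funrpos.
  have mn : measurable_fun setT f^\-%R by exact: measurable_funrneg.
  have int_mfun g : measurable_fun setT g -> mu.-integrable setT (EFin \o g).
    move=> mg; apply/integrableP; split; first exact/measurable_EFinP.
    rewrite (Hmu (fun x => `|g x|)) ?ltry//.
    exact: measurableT_comp.
  split; first exact: int_mfun.
  have fE x : f x = f^\+%R x - f^\-%R x by rewrite -[in LHS](funrposBneg f).
  under eq_integral do rewrite fE EFinB.
  rewrite integralB_EFin//; [|exact: int_mfun..].
  rewrite (Hmu _ mp (funrpos_ge0 f)) (Hmu _ mn (funrneg_ge0 f)).
  rewrite -EFinB /atomic_sum -sumrB; congr EFin; apply: eq_bigr => p _.
  by rewrite -mulrBr fE.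
move=> A mA; rewrite -[LHS](_ : \int[mu]_x (\1_A x)%:E = _)%E.
  by apply: Hmu => // x; rewrite indicE.
by rewrite integral_indic// setIT.
Qed.

(** Monomials are continuous, and the sigma-algebra of [borel_plane R] is the one
    generated by the open sets of the product topology. *)
Lemma monomial_measurable (R : realType) (m n : nat) :
  measurable_fun setT (@monomial R m n).
Proof.
have cont : continuous (fun x : R * R => x.1 ^+ m * x.2 ^+ n).
  move=> x.
  have x1 : (@fst R R) y @[y --> x] --> x.1 by exact: cvg_fst.
  have x2 : (@snd R R) y @[y --> x] --> x.2 by exact: cvg_snd.
  apply: cvgM.
    exact: (cvg_comp _ _ x1 (@exprn_continuous R m x.1)).
  exact: (cvg_comp _ _ x2 (@exprn_continuous R n x.2)).
apply: (measurability (@RGenOpens.G R)).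
  exact: RGenOpens.measurableE.
move=> _ [_ [a [b ->] <-]]; apply: sub_sigma_algebra.
rewrite setTI.
by apply: open_comp => // x _; exact: cont.
Qed.

(** * Gauss quadrature with two nodes *)

Definition pos_hankel (R : realType) (t : nat -> R) : Prop :=
  0 < t 0%N /\ t 1%N ^+ 2 < t 0%N * t 2%N.

(** [p] and [- q] are the roots of [X^2 - c X - v], which have opposite signs
    because their product is [- v < 0]. *)
Lemma product_difference (R : realType) (v c : R) : 0 < v ->
  exists p q : R, [/\ 0 < p, 0 < q, p * q = v & p - q = c].
Proof.
move=> v0; pose d := Num.sqrt (c ^+ 2 + 4 * v).
have d2 : d ^+ 2 = c ^+ 2 + 4 * v by rewrite sqr_sqrtr//; nra.
have d0 : 0 <= d by exact: sqrtr_ge0.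
exists ((d + c) / 2), ((d - c) / 2); split.
- by nra.
- by nra.
- rewrite (_ : _ * _ = (d ^+ 2 - c ^+ 2) / 4); last by field.
  by rewrite d2; field.
- by field.
Qed.

(** Positive definiteness says that the mass [t 0] and the variance are positive.
    Put the origin at the mean [c1] and normalise the mass to 1: let [v] and [k]
    be the second and third central moments.  Two masses at [p] and [- q] with
    mean 0 have weights proportional to [q] and [p]; their variance is [p * q]
    and their third moment [p * q * (p - q)].  It remains to solve [p * q = v]
    and [p - q = k / v]. *)
Lemma two_atom_quadrature (R : realType) (t : nat -> R) : pos_hankel t ->
  exists l : seq (R * R), nonneg_weights l /\
    forall m, (m <= 3)%N -> atomic_sum l (fun x => x ^+ m) = t m.
Proof.
move=> [t0 t12]; pose c1 := t 1%N / t 0%N.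
have tn0 : t 0%N != 0 by rewrite gt_eqF.
have v0 : 0 < t 2%N / t 0%N - c1 ^+ 2.
  rewrite (_ : _ - _ = (t 0%N * t 2%N - t 1%N ^+ 2) / t 0%N ^+ 2); last first.
    by rewrite /c1; field.
  by rewrite divr_gt0 ?subr_gt0// exprn_gt0.
set v := _ - _ in v0.
pose k := t 3%N / t 0%N - 3 * c1 * (t 2%N / t 0%N) + 2 * c1 ^+ 3.
have [p [q [p0 q0 pq pBq]]] := @product_difference R v (k / v) v0.
(* The four moments expressed through [t 0], [c1], [p] and [q]. *)
have e1 : t 1%N = t 0%N * c1 by rewrite /c1; field.
have e2 : t 2%N = t 0%N * (p * q + c1 ^+ 2) by rewrite pq /v; field.
have e3 : t 3%N = t 0%N * (p * q * (p - q) + 3 * c1 * (p * q) + c1 ^+ 3).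
  rewrite pBq pq mulrCA divff ?gt_eqF// /k /v; field => //.
have pqn0 : p + q != 0 by rewrite gt_eqF ?addr_gt0.
exists [:: (t 0%N * (q / (p + q)), c1 + p); (t 0%N * (p / (p + q)), c1 - q)].
split.
  by rewrite /nonneg_weights /= andbT !mulr_ge0 ?invr_ge0// ?addr_ge0// ltW.
rewrite /atomic_sum => m; rewrite !big_cons big_nil /=.
by case: m => [|[|[|[|//]]]] _; rewrite ?e1 ?e2 ?e3; field.
Qed.

(** * The four lines *)

Lemma pos_hankelZ (R : realType) (k : R) (t : nat -> R) :
  0 < k -> pos_hankel t -> pos_hankel (fun m => t m / k).
Proof.
move=> k0 [t0 t12]; split; first exact: divr_gt0.
by rewrite expr_div_n mulf_div -expr2 ltr_pM2r// invr_gt0 exprn_gt0.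
Qed.

(** The determinant of [B * p + e] is a quadratic polynomial in [B] whose leading
    coefficient is the determinant of [p]; similarly for the term of order 0. *)
Lemma pos_hankel_perturb (R : realType) (p e : nat -> R) : pos_hankel p ->
  exists M : R, forall B, M <= B -> pos_hankel (fun m => B * p m + e m).
Proof.
move=> [p0 p12].
pose D := p 0%N * p 2%N - p 1%N ^+ 2.
have D0 : 0 < D by rewrite subr_gt0.
pose E := p 0%N * e 2%N + e 0%N * p 2%N - 2 * (p 1%N * e 1%N).
pose F := e 0%N * e 2%N - e 1%N ^+ 2.
(* The determinant is [B ^+ 2 * D + B * E + F]; for [B >= 1] it is positive when
   [B * D > `|E| + `|F|]. *)
exists (1 + `|e 0%N| / p 0%N + (`|E| + `|F|) / D) => B MB.
have u0 : 0 <= `|e 0%N| / p 0%N by rewrite divr_ge0// ltW.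
have w0 : 0 <= (`|E| + `|F|) / D by apply: divr_ge0; [exact: addr_ge0|exact: ltW].
have B1 : 1 <= B by lra.
split => /=.
  have : `|e 0%N| / p 0%N < B by lra.
  rewrite ltr_pdivrMr// => h; have := ler_norm (- e 0%N); rewrite normrN; lra.
have : (`|E| + `|F|) / D < B by lra.
rewrite ltr_pdivrMr// => h.
rewrite -subr_gt0 (_ : _ - _ = B * (B * D + E) + F); last by rewrite /D /E /F; ring.
have := ler_norm (- E); have := ler_norm (- F); rewrite !normrN => hF hE.
have h1 : `|F| < B * D + E by lra.
have F0 := normr_ge0 F.
nra.
Qed.

Definition on_line (R : realType) (a : R) (l : seq (R * R)) :
    seq (R * borel_plane R) := [seq (p.1, (p.2, a)) | p <- l].

Lemma on_line_weights (R : realType) (a : R) (l : seq (R * R)) :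
  nonneg_weights l -> nonneg_weights (on_line a l).
Proof. by rewrite /nonneg_weights /on_line all_map. Qed.

Lemma atomic_sum_cat (R : realType) (T : Type) (l1 l2 : seq (R * T)) f :
  atomic_sum (l1 ++ l2) f = atomic_sum l1 f + atomic_sum l2 f.
Proof. exact: big_cat. Qed.

Lemma on_line_monomial (R : realType) (a : R) (l : seq (R * R)) m n :
  atomic_sum (on_line a l) (monomial m n) = atomic_sum l (fun x => x ^+ m) * a ^+ n.
Proof.
rewrite /atomic_sum big_map mulr_suml; apply: eq_bigr => p _.
by rewrite mulrA.
Qed.

(** Applied to the complement of [K3], this bounds the support of the measure. *)
Lemma on_line_null (R : realType) (a : R) (l : seq (R * R)) (U : set (borel_plane R)) :
  (forall x, U x -> x.2 <> a) -> atomic_sum (on_line a l) \1_U = 0.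
Proof.
move=> Ua; rewrite /atomic_sum big_map big1// => p _ /=.
by rewrite indicE memNset ?mulr0// => /Ua.
Qed.

Lemma closed_line (R : realType) (a : R) : closed [set x : R * R | x.2 = a].
Proof.
apply: (@closed_comp _ _ snd [set a]); first by move=> x _; exact: cvg_snd.
exact: accessible_closed_set1 (hausdorff_accessible (@Rhausdorff R)) _.
Qed.

Lemma closed_K3 (R : realType) (a0 a1 a2 a3 : R) : closed (K3 a0 a1 a2 a3).
Proof. by rewrite /K3; do !apply: closedU; exact: closed_line. Qed.

(** The planar problem on four horizontal lines reduces to four problems on the
    real line.  The support is contained in [K3] because [K3] is closed and its
    complement, an open set without atoms, has measure 0. *)
Lemma K3_problem_of_lines (R : realType) (s : nat -> nat -> R) (a0 a1 a2 a3 : R)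
    (t0 t1 t2 t3 : nat -> R) :
  pos_hankel t0 -> pos_hankel t1 -> pos_hankel t2 -> pos_hankel t3 ->
  (forall m n, (m <= 3)%N -> (n <= 3)%N ->
     t0 m * a0 ^+ n + t1 m * a1 ^+ n + t2 m * a2 ^+ n + t3 m * a3 ^+ n = s m n) ->
  exists mu : {measure set (borel_plane R) -> \bar R},
    solves_K_moment_problem (K3 a0 a1 a2 a3) 3 3 s mu.
Proof.
move=> /two_atom_quadrature[l0 [w0 m0]] /two_atom_quadrature[l1 [w1 m1]].
move=> /two_atom_quadrature[l2 [w2 m2]] /two_atom_quadrature[l3 [w3 m3]] ts.
pose l := on_line a0 l0 ++ on_line a1 l1 ++ on_line a2 l2 ++ on_line a3 l3.
have wl : nonneg_weights l.
  by rewrite /nonneg_weights !all_cat; apply/and4P; split; exact: on_line_weights.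
have [mu [mu_int mu_set]] := @atomic_measure _ _ R l wl.
exists mu; split.
  move=> m n m3' n3'; have [? ->] := mu_int _ (@monomial_measurable R m n).
  split=> //; congr EFin; rewrite -ts// !atomic_sum_cat !on_line_monomial.
  by rewrite m0 // m1 // m2 // m3 // !addrA.
move=> x; apply: contraPP => xK /(_ (~` K3 a0 a1 a2 a3)).
have oK : open (~` K3 a0 a1 a2 a3) by exact/closed_openC/closed_K3.
move=> /(_ oK xK); rewrite mu_set; last exact: sub_sigma_algebra.
rewrite !atomic_sum_cat !on_line_null ?addr0 ?ltxx//.
all: move=> y /= yK ya; apply: yK; rewrite /K3 /=; tauto.
Qed.

(** The four sequences of moments are those of Lagrange interpolation at
    [-b, -a, a, b], up to the positive denominators [2 * b * (b ^+ 2 - a ^+ 2)]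
    and [2 * a * (b ^+ 2 - a ^+ 2)]. *)
Lemma K3_solvable (R : realType) (s : nat -> nat -> R) (h00 : 0 < s 0%N 0%N)
    (a : R) : admissible_a2 s a ->
  exists b : R, 0 < b /\ a < b /\
    exists mu : {measure set (borel_plane R) -> \bar R},
      solves_K_moment_problem (K3 (- b) (- a) a b) 3 3 s mu.
Proof.
move=> [[[/=]]]; rewrite in_itv/= => /andP[a_lo a_hi] [a0 H1] [_ H2] [_ H3].
have s01 : `|s 0%N 1%N| < a * s 0%N 0%N by rewrite -ltr_pdivrMr.
have s01r := ler_norm (s 0%N 1%N).
have s01l := ler_norm (- s 0%N 1%N); rewrite normrN in s01l.
have s02 : a ^+ 2 * s 0%N 0%N < s 0%N 2%N.
  rewrite -ltr_pdivlMr// -ltr_sqrt; last first.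
    by rewrite -sqrtr_gt0 (lt_trans a0).
  by rewrite sqrtr_sqr ger0_norm// ltW.
have Hout : pos_hankel (fun m => s m 2%N - a ^+ 2 * s m 0%N).
  by split; [rewrite subr_gt0|move: H1; rewrite !mulNr ![- _ + s _ _]addrC].
have Hm : pos_hankel (fun m => a * s m 0%N - s m 1%N) by split => //; lra.
have Hp : pos_hankel (fun m => a * s m 0%N + s m 1%N) by split => //; lra.
(* [P1], [P2], [P3], [P4] concern the lines [b], [-b], [-a], [a]; the large
   parameter is [b] in the first two and [b ^+ 2] in the last two. *)
have [M1 P1] := pos_hankel_perturb (fun m => s m 3%N - a ^+ 2 * s m 1%N) Hout.
have [M2 P2] := pos_hankel_perturb (fun m => a ^+ 2 * s m 1%N - s m 3%N) Hout.
have [M3 P3] := pos_hankel_perturb (fun m => s m 3%N - a * s m 2%N) Hm.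
have [M4 P4] := pos_hankel_perturb (fun m => - s m 3%N - a * s m 2%N) Hp.
(* The summand 1 gives [b <= b ^+ 2], so that [b ^+ 2] is large as well. *)
pose b := 1 + a + `|M1| + `|M2| + `|M3| + `|M4|.
have := ler_norm M1; have := ler_norm M2; have := ler_norm M3.
have := ler_norm M4; move: (normr_ge0 M1) (normr_ge0 M2) (normr_ge0 M3) (normr_ge0 M4).
move=> g1 g2 g3 g4 h4 h3 h2 h1.
have b1 : 1 <= b by rewrite /b; lra.
have ab : a < b by rewrite /b; lra.
have b2 : b <= b ^+ 2 by rewrite expr2 ler_peMl//; lra.
have b0 : 0 < b by lra.
have {}P1 := P1 b ltac:(rewrite /b; lra).
have {}P2 := P2 b ltac:(rewrite /b; lra).
have {}P3 := P3 (b ^+ 2) ltac:(apply: le_trans b2; rewrite /b; lra).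
have {}P4 := P4 (b ^+ 2) ltac:(apply: le_trans b2; rewrite /b; lra).
have c0 : 0 < b ^+ 2 - a ^+ 2 by rewrite subr_gt0; nra.
have kb : 0 < 2 * b * (b ^+ 2 - a ^+ 2) by rewrite !mulr_gt0.
have ka : 0 < 2 * a * (b ^+ 2 - a ^+ 2) by rewrite !mulr_gt0.
exists b; split=> //; split=> //.
apply: (K3_problem_of_lines (pos_hankelZ kb P2) (pos_hankelZ ka P3)
         (pos_hankelZ ka P4) (pos_hankelZ kb P1)).
have an0 : a != 0 by rewrite gt_eqF.
have bn0 : b != 0 by rewrite gt_eqF.
have cn0 : b ^+ 2 - a ^+ 2 != 0 by rewrite gt_eqF.
move=> m [|[|[|[|//]]]] _ _; field.
all: by rewrite an0 bn0 cn0.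
Qed.

Theorem theorem3 (R : realType) (s : nat -> nat -> R)
    (h00 : 0 < s 0%N 0%N)
    (h02 : 0 < s 0%N 0%N * s 0%N 2%N - s 0%N 1%N ^+ 2)
    (h20 : 0 < s 0%N 0%N * s 2%N 0%N - s 1%N 0%N ^+ 2) :
  (admissible_a2 s !=set0 ->
     exists mu : {measure set (borel_plane R) -> \bar R},
       solves_moment_problem 3 3 s mu)
  /\
  (forall a2 : R, admissible_a2 s a2 ->
     exists a3 : R, 0 < a3 /\ a2 < a3 /\
       exists mu : {measure set (borel_plane R) -> \bar R},
         solves_K_moment_problem (K3 (- a3) (- a2) a2 a3) 3 3 s mu /\
         solves_moment_problem 3 3 s mu).
Proof.
split=> [[a]|a] /(K3_solvable h00)[b [b0 [ab [mu Hmu]]]].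
  by exists mu; exact: Hmu.1.
by exists b; split=> //; split=> //; exists mu; split; [|exact: Hmu.1].
Qed.
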